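(* Let $L$ be a valid lattice and $\varphi\in\mathscr{F}(L)\cap\operatorname{int}(Q)$, where $Q=\{(x,y)\in\mathbb{R}^2:|x|+|y|\le\frac12\}$. Then any two distinct tilings of $\mathbb{T}_L$ with flux $\varphi$ can be joined by a (finite) sequence of flips.
   Context: The unit square $[i,i+1]\times[j,j+1]$ ($i,j\in\mathbb{Z}$) is black if $i+j$ is even and white otherwise. A domino is the union of two unit squares sharing a side; a tiling of $\mathbb{Z}^2$ is a set of dominoes with pairwise disjoint interiors covering $\mathbb{R}^2$. Let $\mathscr{E}=2\mathbb{Z}^2$, $\mathscr{O}=2\mathbb{Z}^2+(1,1)$. A valid lattice is a subgroup $L\subset\mathbb{Z}^2$ generated by two linearly independent vectors in $\mathscr{E}\sqcup\mathscr{O}$. A tiling of $\mathbb{T}_L=\mathbb{R}^2/L$ is identified with an $L$-periodic tiling of $\mathbb{Z}^2$. Flips on the torus: if two parallel dominoes of an $L$-periodic tiling $t$ form a $2\times2$ square with center $v\in\mathbb{Z}^2$, then the same holds around each point of $v+L$, and a flip of $t$ (as a tiling of $\mathbb{T}_L$), also called an $L$-flip round $v$, replaces, simultaneously around every point of $v+L$, these two dominoes by the other two-domino tiling of the $2\times 2$ square. The result is again a tiling of $\mathbb{T}_L$. Height functions: each unit edge between neighboring points of $\mathbb{Z}^2$ is oriented so that the boundary of every black square is oriented clockwise. The height function $h_t:\mathbb{Z}^2\to\mathbb{Z}$ of a tiling $t$ satisfies $h_t(0)=0$ and, for every edge oriented from $u$ to $w$: $h_t(w)=h_t(u)+1$ if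 the edge is not the common side of the two squares of a domino of $t$, and $h_t(w)=h_t(u)-3$ otherwise. Flux: for a tiling $t$ of $\mathbb{T}_L$, $h_t(u+v)-h_t(u)$ depends only on $v\in L$ and is additive in $v$; the flux of $t$ is the unique $\varphi_t\in\mathbb{R}^2$ with $4\langle\varphi_t,v\rangle=h_t(u+v)-h_t(u)$ for all $v\in L$, $u\in\mathbb{Z}^2$. $\mathscr{F}(L)$ is the set of fluxes of all tilings of $\mathbb{T}_L$. *)

(* Defs.v *)
(* MathComp / MathComp-Analysis. *)
From mathcomp Require Import all_boot all_order all_algebra.
From mathcomp Require Import all_classical all_reals all_analysis.
From Stdlib Require Import Relation_Operators.

Set Implicit Arguments.
Unset Strict Implicit.
Unset Printing Implicit Defensive.

Import Order.TTheory GRing.Theory Num.Theory.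
Import numFieldNormedType.Exports.

Local Open Scope classical_set_scope.
Local Open Scope ring_scope.

(* The same type serves for the points of Z^2 and for the unit squares: the
   square [i, i+1] x [j, j+1] is represented by its lower left corner (i, j). *)
Notation Z2 := (int * int)%type.

Definition e1 : Z2 := (1, 0).
Definition e2 : Z2 := (0, 1).

Definition black (s : Z2) : Prop := (2 %| s.1 + s.2)%Z.

(* (u, w) is one of the four sides of s, oriented as in the clockwise boundary
   of s. *)
Definition clockwise_side (s u w : Z2) : Prop :=
  [\/ u = s /\ w = s + e2,
      u = s + e2 /\ w = s + e1 + e2,
      u = s + e1 + e2 /\ w = s + e1 |
      u = s + e1 /\ w = s].

Definition is_side (s u w : Z2) : Prop :=
  clockwise_side s u w \/ clockwise_side s w u.

(* Every unit edge is a side of exactly one black square, so this orients each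
   edge in exactly one direction. *)
Definition oriented_edge (u w : Z2) : Prop :=
  exists2 s, black s & clockwise_side s u w.

Definition common_side (s s' u w : Z2) : Prop :=
  [/\ s <> s', is_side s u w & is_side s' u w].

(* A domino is represented by the set of its two unit squares. *)
Definition is_domino (d : set Z2) : Prop :=
  exists s s', (exists u w, common_side s s' u w) /\ d = [set s; s'].

(* Unions of unit squares have disjoint interiors iff they have no unit square
   in common, and cover the plane iff they contain every unit square. *)
Definition is_tiling (t : set (set Z2)) : Prop :=
  [/\ t `<=` is_domino, trivIset t id & \bigcup_(d in t) d = setT].

Definition even_points : set Z2 := [set x *+ 2 | x in setT].
Definition odd_points : set Z2 := [set x *+ 2 + (e1 + e2) | x in setT].

Definition lin_indep (a b : Z2) : Prop :=
  forall m n : int, a *~ m + b *~ n = 0 -> m = 0 /\ n = 0.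

Definition subgroup_gen (a b : Z2) : set Z2 :=
  [set x | exists m n : int, x = a *~ m + b *~ n].

Definition valid_lattice (L : set Z2) : Prop :=
  exists a b, [/\ (even_points `|` odd_points) a,
                  (even_points `|` odd_points) b,
                  lin_indep a b & L = subgroup_gen a b].

Definition translate (v : Z2) (d : set Z2) : set Z2 := [set s + v | s in d].

(* Tilings of the torus R^2 / L, as L-periodic tilings of Z^2. *)
Definition torus_tiling (L : set Z2) (t : set (set Z2)) : Prop :=
  is_tiling t /\ forall v, L v -> [set translate v d | d in t] = t.

(* The two tilings by two dominoes of the 2 x 2 square with center v. *)
Definition hpair (v : Z2) : set (set Z2) :=
  [set [set v - e1 - e2; v - e2]; [set v - e1; v]].
Definition vpair (v : Z2) : set (set Z2) :=
  [set [set v - e1 - e2; v - e1]; [set v - e2; v]].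

Definition orbit_pairs (L : set Z2) (pair : Z2 -> set (set Z2)) (v : Z2) :
  set (set Z2) := \bigcup_(l in L) pair (v + l).

Definition flip_round (L : set Z2) (v : Z2) (t t' : set (set Z2)) : Prop :=
  (hpair v `<=` t /\
     t' = (t `\` orbit_pairs L hpair v) `|` orbit_pairs L vpair v) \/
  (vpair v `<=` t /\
     t' = (t `\` orbit_pairs L vpair v) `|` orbit_pairs L hpair v).

Definition flip (L : set Z2) (t t' : set (set Z2)) : Prop :=
  exists v, flip_round L v t t'.

(* The flip of a tiling of the torus is again one, so all the terms of the
   sequence are tilings of the torus as soon as the first one is. *)
Definition joined_by_flips (L : set Z2) : set (set Z2) -> set (set Z2) -> Prop :=
  clos_refl_trans_1n _ (flip L).

Definition domino_crosses (t : set (set Z2)) (u w : Z2) : Prop :=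
  exists s s', t [set s; s'] /\ common_side s s' u w.

(* Every tiling has exactly one height function. *)
Definition is_height (t : set (set Z2)) (h : Z2 -> int) : Prop :=
  h 0 = 0 /\
  forall u w, oriented_edge u w ->
    (~ domino_crosses t u w -> h w = h u + 1) /\
    (domino_crosses t u w -> h w = h u - 3).

Definition dotZ (R : realType) (p : R * R) (v : Z2) : R :=
  p.1 * v.1%:~R + p.2 * v.2%:~R.

Definition is_flux (R : realType) (L : set Z2) (t : set (set Z2)) (phi : R * R) :
    Prop :=
  exists2 h, is_height t h &
    forall v u : Z2, L v -> 4 * dotZ phi v = (h (u + v) - h u)%:~R.

Definition fluxes (R : realType) (L : set Z2) : set (R * R) :=
  [set phi | exists2 t, torus_tiling L t & is_flux L t phi].

Definition Qset (R : realType) : set (R * R) :=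
  [set p | `|p.1| + `|p.2| <= 2^-1].

Arguments fluxes R L : clear implicits.
Arguments Qset R : clear implicits.

(* Main.v *)
(* Height functions turn the problem into one about functions h on Z^2 which gain 1
   or lose 3 along every oriented edge: lowering h by 4 on an L-orbit of local maxima
   is a flip, and the sum over a period of |h1 - h2| measures the distance left.
   Where h1 - h2 is maximal and positive, any step up of h1 is also a step up of h2
   and so stays in the maximal set; if that set had no local maximum of h1, it would
   contain an infinite path on which h1 gains 1 at each step. Oriented paths alternate
   horizontal and vertical edges, so modulo L such a path yields v in L and n > 0 with
   |v|_oo <= n and 4 <phi, v> = 2 n, which is impossible when |phi|_1 < 1/2. *)
Require Import Defs.
From mathcomp Require Import all_boot all_order all_algebra.
From mathcomp Require Import all_classical all_reals all_analysis.
From mathcomp Require Import zify ring lra.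
From Stdlib Require Import Relation_Operators Operators_Properties.

Set Implicit Arguments.
Unset Strict Implicit.
Unset Printing Implicit Defensive.

Import Order.TTheory GRing.Theory Num.Theory.
Import numFieldNormedType.Exports.
Local Open Scope classical_set_scope.
Local Open Scope ring_scope.

(** * Sets of dominoes, and flips in terms of heights *)

Lemma pair_eq_inv (a b c d : int) : (a, b) = (c, d) -> a = c /\ b = d.
Proof. by case. Qed.

Lemma set2_inj (T : Type) (x y z w : T) :
  [set x; y] = [set z; w] -> (x = z /\ y = w) \/ (x = w /\ y = z).
Proof.
move=> E.
have : [set z; w] x by rewrite -E; left.
have : [set z; w] y by rewrite -E; right.
have : [set x; y] z by rewrite E; left.
have : [set x; y] w by rewrite E; right.
rewrite /= => -[->|->] [->|->] [] h1 [] h2; subst; tauto.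
Qed.

(** [P] holds the left squares of the horizontal dominoes and [Q] the lower squares of the vertical
    ones; unions and differences are then computed separately on [P] and on [Q]. *)
Definition dominoes (P Q : set Z2) : set (set Z2) :=
  [set [set x; x + e1] | x in P] `|` [set [set x; x + e2] | x in Q].

Lemma dominoes_h P Q x : dominoes P Q [set x; x + e1] <-> P x.
Proof.
split; last by move=> Px; left; exists x.
case=> -[y Py] E0; have E := set2_inj E0.
  suff <- : y = x by [].
  case: E => [[] // |[]].
  by case: x y {Py E0} => [a b] [c d] /pair_eq_inv /= ? /pair_eq_inv /= ?; lia.
by case: E; case: x y {Py E0} => [a b] [c d] [/pair_eq_inv /= ? /pair_eq_inv /= ?];
  lia.
Qed.

Lemma dominoes_v P Q x : dominoes P Q [set x; x + e2] <-> Q x.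
Proof.
split; last by move=> Qx; right; exists x.
case=> -[y Qy] E0; have E := set2_inj E0; last first.
  suff <- : y = x by [].
  case: E => [[] // |[]].
  by case: x y {Qy E0} => [a b] [c d] /pair_eq_inv /= ? /pair_eq_inv /= ?; lia.
by case: E; case: x y {Qy E0} => [a b] [c d] [/pair_eq_inv /= ? /pair_eq_inv /= ?];
  lia.
Qed.

Lemma dominoesU P Q P' Q' :
  dominoes P Q `|` dominoes P' Q' = dominoes (P `|` P') (Q `|` Q').
Proof. by rewrite /dominoes setUACA !image_setU. Qed.

Lemma dominoesD P Q P' Q' :
  dominoes P Q `\` dominoes P' Q' = dominoes (P `\` P') (Q `\` Q').
Proof.
apply/seteqP; split=> d.
  case=> -[[x Px <-]|[x Qx <-]].
    by move/dominoes_h => nP; left; exists x.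
  by move/dominoes_v => nQ; right; exists x.
case=> -[x [Px nPx] <-]; split.
- by left; exists x.
- by move/dominoes_h.
- by right; exists x.
- by move/dominoes_v.
Qed.

(* The vertical edge at the middle of the domino [x; x + e1] has an endpoint in
   [V]; likewise for the horizontal edge at the middle of [x; x + e2]. *)
Definition touch_h (V : set Z2) : set Z2 := [set x | V (x + e1) \/ V (x + e1 + e2)].
Definition touch_v (V : set Z2) : set Z2 := [set x | V (x + e2) \/ V (x + e1 + e2)].

(** The dominoes of [hpair w] are exactly the horizontal ones whose middle edge ends at [w]. *)
Lemma orbit_hpair L v :
  orbit_pairs L hpair v = dominoes (touch_h [set v + l | l in L]) set0.
Proof.
apply/seteqP; split=> d.
  case=> l Ll [] ->.
    left; exists (v + l - e1 - e2); last by congr [set _; _]; ring.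
    by right; exists l => //; ring.
  left; exists (v + l - e1); last by congr [set _; _]; ring.
  by left; exists l => //; ring.
case=> -[x //= [[l Ll E]|[l Ll E]] <-]; exists l => //; rewrite E; [right|left];
  by congr [set _; _]; ring.
Qed.

Lemma orbit_vpair L v :
  orbit_pairs L vpair v = dominoes set0 (touch_v [set v + l | l in L]).
Proof.
apply/seteqP; split=> d.
  case=> l Ll [] ->.
    right; exists (v + l - e1 - e2); last by congr [set _; _]; ring.
    by right; exists l => //; ring.
  right; exists (v + l - e2); last by congr [set _; _]; ring.
  by left; exists l => //; ring.
case=> -[x //= [[l Ll E]|[l Ll E]] <-]; exists l => //; rewrite E; [right|left];
  by congr [set _; _]; ring.
Qed.

(* Across an edge, a height changes by 3 exactly when the edge is covered. *)
Definition covered (h : Z2 -> int) (u w : Z2) : Prop :=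
  h u = h w + 3 \/ h w = h u + 3.

(** This makes sense for every [h], so that flips can be studied on heights alone;
    [is_height_tiling] recovers a tiling from its height function in this way. *)
Definition height_tiling (h : Z2 -> int) : set (set Z2) :=
  dominoes [set x | covered h (x + e1) (x + e1 + e2)]
           [set x | covered h (x + e2) (x + e1 + e2)].

Lemma coveredC h u w : covered h u w -> covered h w u.
Proof. by case; [right|left]. Qed.

(** A domino whose middle edge misses [V] lies in both sets or in neither, since [h] and [h'] agree
    at both ends of that edge. Of the dominoes whose middle edge touches [V], the first set has all
    the horizontal and no vertical ones, the second set the reverse. *)
Lemma flip_height_tiling L v h h' (V := [set v + l | l in L]) : L 0 ->
  (forall x, ~ V x -> h' x = h x) ->
  (forall x, V x -> [/\ covered h x (x + e2), covered h x (x - e2),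
     ~ covered h x (x + e1) & ~ covered h x (x - e1)]) ->
  (forall x, V x -> [/\ covered h' x (x + e1), covered h' x (x - e1),
     ~ covered h' x (x + e2) & ~ covered h' x (x - e2)]) ->
  flip L (height_tiling h) (height_tiling h') /\
  flip L (height_tiling h') (height_tiling h).
Proof.
move=> L0 hoff hV hV'.
have K1 (x : Z2) : x + e1 + e2 - e2 = x + e1 by ring.
have K2 (x : Z2) : x + e1 + e2 - e1 = x + e2 by ring.
have K3 (x : Z2) : x + e2 + e1 = x + e1 + e2 by ring.
have Th x : touch_h V x ->
    covered h (x + e1) (x + e1 + e2) /\ ~ covered h' (x + e1) (x + e1 + e2).
  case=> Vx.
    by have [? ? ? ?] := hV _ Vx; have [? ? ? ?] := hV' _ Vx.
  have := hV _ Vx; have := hV' _ Vx; rewrite K1 K2 => -[? ? ? h1] [? h2 ? ?].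
  by split=> [|/coveredC //]; exact: coveredC.
have Tv x : touch_v V x ->
    ~ covered h (x + e2) (x + e1 + e2) /\ covered h' (x + e2) (x + e1 + e2).
  case=> Vx.
    by have := hV _ Vx; have := hV' _ Vx; rewrite K3 => -[? ? ? ?] [? ? ? ?].
  have := hV _ Vx; have := hV' _ Vx; rewrite K1 K2 => -[? h1 ? ?] [? ? ? h2].
  by split=> [/coveredC //|]; exact: coveredC.
have nT x : ~ touch_h V x ->
    covered h' (x + e1) (x + e1 + e2) <-> covered h (x + e1) (x + e1 + e2).
  by move=> n; rewrite /covered !hoff// => ?; apply: n; [right|left].
have nTv x : ~ touch_v V x ->
    covered h' (x + e2) (x + e1 + e2) <-> covered h (x + e2) (x + e1 + e2).
  by move=> n; rewrite /covered !hoff// => ?; apply: n; [right|left].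
split; exists v; [left|right]; rewrite orbit_hpair orbit_vpair -/V; split.
- have V0 : V v by exists 0 => //; ring.
  move=> d [] ->.
    rewrite (_ : v - e2 = v - e1 - e2 + e1); last by ring.
    apply/dominoes_h; apply: (proj1 (Th _ _)); right.
    by rewrite (_ : _ - _ - _ + _ + _ = v); last ring.
  rewrite -[X in [set _; X]](subrK e1).
  apply/dominoes_h; apply: (proj1 (Th _ _)); left.
  by rewrite subrK.
- rewrite dominoesD dominoesU setD0 setU0 /height_tiling; congr dominoes.
    apply/seteqP; split=> x /=.
      by move=> c; have [t|t] := pselect (touch_h V x); [case: (Th _ t)|
        split=> //; apply/nT].
    by case=> c t; apply/nT.
  apply/seteqP; split=> x /=.
    by move=> c; have [t|t] := pselect (touch_v V x); [right|left; apply/nTv].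
  by case=> [c|/Tv[]//]; have [t|t] := pselect (touch_v V x); [case: (Tv _ t)|
    apply/nTv].
- have V0 : V v by exists 0 => //; ring.
  move=> d [] ->.
    rewrite [X in [set _; X]](_ : _ = v - e1 - e2 + e2); last by ring.
    apply/dominoes_v; apply: (proj2 (Tv _ _)); right.
    by rewrite (_ : _ - _ - _ + _ + _ = v); last ring.
  rewrite -[X in [set _; X]](subrK e2).
  apply/dominoes_v; apply: (proj2 (Tv _ _)); left.
  by rewrite subrK.
- rewrite dominoesD dominoesU setD0 setU0 /height_tiling; congr dominoes.
    apply/seteqP; split=> x /=.
      by move=> c; have [t|t] := pselect (touch_h V x); [right|left; apply/nT].
    by case=> [c|/Th[]//]; have [t|t] := pselect (touch_h V x); [case: (Th _ t)|
      apply/nT].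
  apply/seteqP; split=> x /=.
    by move=> c; have [t|t] := pselect (touch_v V x); [case: (Tv _ t)|
      split=> //; apply/nTv].
  by case=> c t; apply/nTv.
Qed.

(** * Colours, oriented edges, and the height function of a tiling *)

Definition blackb (x : Z2) : bool := (2 %| x.1 + x.2)%Z.

Lemma blackb1 x : (blackb (x + e1) = ~~ blackb x) * (blackb (x - e1) = ~~ blackb x).
Proof. case: x => i j; rewrite /blackb /=; split; lia. Qed.

Lemma blackb2 x : (blackb (x + e2) = ~~ blackb x) * (blackb (x - e2) = ~~ blackb x).
Proof. case: x => i j; rewrite /blackb /=; split; lia. Qed.

(** Puts a domino into one of the two normal forms of [dominoes], with the shared side as its middle
    edge. *)
Lemma common_sideP s s' u w : common_side s s' u w ->
  exists x,
    ([set s; s'] = [set x; x + e1] /\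
     (u = x + e1 /\ w = x + e1 + e2 \/ w = x + e1 /\ u = x + e1 + e2)) \/
    ([set s; s'] = [set x; x + e2] /\
     (u = x + e2 /\ w = x + e1 + e2 \/ w = x + e2 /\ u = x + e1 + e2)).
Proof.
have swap (y z : Z2) : [set y; z] = [set z; y] by rewrite setUC.
have Z2E (a b c d : int) : a = c -> b = d -> (a, b) = (c, d) by move=> -> ->.
have num (a b c d i j : int) : is_side (i, j) (a, b) (c, d) ->
  ((a = i \/ a = i + 1) /\ a = c /\ (b = j /\ d = j + 1 \/ d = j /\ b = j + 1)) \/
  ((b = j \/ b = j + 1) /\ b = d /\ (a = i /\ c = i + 1 \/ c = i /\ a = i + 1)).
  by case=> -[[]|[]|[]|[]] /pair_eq_inv /= [-> ->] /pair_eq_inv /= [-> ->]; lia.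
case: s s' u w => [i j] [k l] [a b] [c d] [ne /num S /num S'].
have {}ne : ~ (i = k /\ j = l) by move=> [? ?]; apply: ne; exact: Z2E.
have : (k = i + 1 /\ l = j /\ (a = i + 1 /\ b = j /\ c = i + 1 /\ d = j + 1 \/
                              c = i + 1 /\ d = j /\ a = i + 1 /\ b = j + 1)) \/
  (i = k + 1 /\ j = l /\ (a = k + 1 /\ b = l /\ c = k + 1 /\ d = l + 1 \/
                              c = k + 1 /\ d = l /\ a = k + 1 /\ b = l + 1)) \/
  (k = i /\ l = j + 1 /\ (a = i /\ b = j + 1 /\ c = i + 1 /\ d = j + 1 \/
                              c = i /\ d = j + 1 /\ a = i + 1 /\ b = j + 1)) \/
  (i = k /\ j = l + 1 /\ (a = k /\ b = l + 1 /\ c = k + 1 /\ d = l + 1 \/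
                              c = k /\ d = l + 1 /\ a = k + 1 /\ b = l + 1)).
  have [ik|ik] := eqVneq i k.
    case: S => -[p [q r]]; case: S' => -[p' [q' r']]; try by exfalso; lia.
    have [jl|jl] : j = l + 1 \/ l = j + 1 by clear r r'; lia.
      by right; right; right; clear r'; lia.
    by right; right; left; clear r'; lia.
  case: S => -[p [q r]]; case: S' => -[p' [q' r']]; try by exfalso; lia.
  have lj : j = l by clear p p'; lia.
  have [jl|jl] : i = k + 1 \/ k = i + 1 by clear r r'; lia.
    by right; left; clear r'; lia.
  by left; clear r'; lia.
have addE (p q r s : int) : (p, q) + (r, s) = (p + r, q + s) :> Z2 by [].
rewrite /e1 /e2 => -[|[|[]]] [E1 [E2 E3]]; [exists (i, j)|exists (k, l)|exists (i, j)|exists (k, l)];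
 [left|left|right|right]; rewrite !addE; (split; [|
  by case: E3 => E3; [left|right]; split; apply: Z2E; rewrite /=; lia]).
- by congr [set _; _]; apply: Z2E; rewrite /=; lia.
- by rewrite [in LHS]swap; congr [set _; _]; apply: Z2E; rewrite /=; lia.
- by congr [set _; _]; apply: Z2E; rewrite /=; lia.
- by rewrite [in LHS]swap; congr [set _; _]; apply: Z2E; rewrite /=; lia.
Qed.

(* The orientation leaves [x] towards [x + outd x] and [x - outd x], and enters it from
   [x + ind x] and [x - ind x]. *)
Definition outd (x : Z2) : Z2 := if blackb x then e2 else e1.
Definition ind (x : Z2) : Z2 := if blackb x then e1 else e2.

Lemma outd_add x d : d \in [:: e1; e2; - e1; - e2] ->
  outd (x + d) = ind x /\ ind (x + d) = outd x.
Proof.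
by rewrite !inE => /or4P[] /eqP ->; rewrite /outd /ind ?blackb1 ?blackb2; case: blackb.
Qed.

Lemma outd_mem x : (outd x \in [:: e1; e2; - e1; - e2]) *
  (ind x \in [:: e1; e2; - e1; - e2]) *
  (- outd x \in [:: e1; e2; - e1; - e2]) * (- ind x \in [:: e1; e2; - e1; - e2]).
Proof. by rewrite /outd /ind; case: blackb; rewrite !inE !eqxx ?orbT. Qed.

(** Each witness is the black one of the two squares that border the edge. *)
Lemma oriented_outd x : oriented_edge x (x + outd x) /\ oriented_edge x (x - outd x).
Proof.
rewrite /outd; case: ifPn => bx; split.
- by exists x => //; constructor 1.
- exists (x - e1 - e2); first by rewrite /black -/(blackb _) blackb2 blackb1 negbK.
  by constructor 3; split; ring.
- exists (x - e2); first by rewrite /black -/(blackb _) blackb2.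
  by constructor 2; split; ring.
- exists (x - e1); first by rewrite /black -/(blackb _) blackb1.
  by constructor 4; split; ring.
Qed.

Definition height_step (a b : int) : Prop := b = a + 1 \/ b = a - 3.

(** The value at 0 is left free, since a flip may lower it. The edges entering [x] are constrained
    as edges leaving its neighbours. *)
Definition height (h : Z2 -> int) : Prop := forall x,
  height_step (h x) (h (x + outd x)) /\ height_step (h x) (h (x - outd x)).

Lemma is_height_height t h : is_height t h -> height h.
Proof.
case=> _ H x; have [io io'] := oriented_outd x.
split.
  have [n c] := H _ _ io; have [/c|/n] := pselect (domino_crosses t x (x + outd x));
    by [right|left].
have [n c] := H _ _ io'; have [/c|/n] := pselect (domino_crosses t x (x - outd x));
  by [right|left].
Qed.

Lemma domino_crossesC t u w : domino_crosses t u w -> domino_crosses t w u.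
Proof.
move=> [s [s' [ts [ne S S']]]]; exists s, s'; split=> //; split=> //.
  by case: S; [right|left].
by case: S'; [right|left].
Qed.

Lemma is_height_covered t h x d : is_height t h -> d \in [:: e1; e2; - e1; - e2] ->
  covered h x (x + d) <-> domino_crosses t x (x + d).
Proof.
move=> [_ H] dm.
have cov u w : oriented_edge u w -> covered h u w <-> domino_crosses t u w.
  move=> /H[n c]; split; last by move=> /c; rewrite /covered; lia.
  by move=> cv; apply: contrapT => /n; move: cv; rewrite /covered; lia.
have [io io'] := oriented_outd x.
have [p p'] := oriented_outd (x + d).
have [E _] := outd_add x dm.
have {p'} : oriented_edge x (x + d) \/ oriented_edge (x + d) x.
  move: io io' p p'; rewrite E {E}; move: dm; rewrite !inE /outd /ind.
  by case: blackb => /or4P[] /eqP ->; rewrite ?addrK ?subrK ?opprK; tauto.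
case=> /cov C //; split.
  by move/coveredC/C/domino_crossesC.
by move/domino_crossesC/C/coveredC.
Qed.

(** A domino crosses its middle edge, and no other domino crosses that edge; so the edges across
    which the height changes by 3 determine [t]. *)
Lemma is_height_tiling t h : is_tiling t -> is_height t h -> t = height_tiling h.
Proof.
move=> [dom _ _] H.
have K3 (x : Z2) : x + e1 + e2 = x + e2 + e1 by ring.
have c1 x : covered h (x + e1) (x + e1 + e2) <-> domino_crosses t (x + e1) (x + e1 + e2).
  exact: is_height_covered.
have c2 x : covered h (x + e2) (x + e1 + e2) <-> domino_crosses t (x + e2) (x + e1 + e2).
  by rewrite K3; exact: is_height_covered.
apply/seteqP; split=> d.
  move=> td; have [s [s' [[u [w C]] E]]] := dom _ td.
  have X : domino_crosses t u w by exists s, s'; rewrite -E.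
  have [x [[E' F]|[E' F]]] := common_sideP C; rewrite E E'.
    by apply/dominoes_h/c1; case: F X => -[-> ->] // /domino_crossesC.
  by apply/dominoes_v/c2; case: F X => -[-> ->] // /domino_crossesC.
case=> -[x /= Cx <-].
  have [s [s' [ts /common_sideP [y [] [E F]]]]] := proj1 (c1 _) Cx.
    rewrite E in ts; suff <- : y = x by [].
    case: x y F {Cx E ts} => [a b] [c e].
    by case=> -[/pair_eq_inv /= ? /pair_eq_inv /= ?]; congr pair; lia.
  case: x y F {Cx E ts} => [a b] [c e].
  by case=> -[/pair_eq_inv /= ? /pair_eq_inv /= ?]; lia.
have [s [s' [ts /common_sideP [y [] [E F]]]]] := proj1 (c2 _) Cx.
  case: x y F {Cx E ts} => [a b] [c e].
  by case=> -[/pair_eq_inv /= ? /pair_eq_inv /= ?]; lia.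
rewrite E in ts; suff <- : y = x by [].
case: x y F {Cx E ts} => [a b] [c e].
by case=> -[/pair_eq_inv /= ? /pair_eq_inv /= ?]; congr pair; lia.
Qed.

(** * Lowering a height function at local maxima *)

Definition local_max (h : Z2 -> int) (u : Z2) : Prop :=
  h (u + outd u) = h u - 3 /\ h (u - outd u) = h u - 3.

(* The steps around a square sum to zero, so exactly one of them is -3: for the squares
   at [u], it is the one along the edge leaving [u]. *)
Lemma local_max_ind h u : height h -> local_max h u ->
  h (u + ind u) = h u - 1 /\ h (u - ind u) = h u - 1.
Proof.
move=> H [hp hm].
have sq d d' : (d = outd u \/ d = - outd u) -> (d' = ind u \/ d' = - ind u) ->
    h (u + d') = h u - 1.
  move=> Ed Ed'.
  have md : d \in [:: e1; e2; - e1; - e2] by case: Ed => ->; rewrite outd_mem.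
  have md' : d' \in [:: e1; e2; - e1; - e2] by case: Ed' => ->; rewrite outd_mem.
  have hd : h (u + d) = h u - 3 by case: Ed => ->.
  have [ot1 it1] := outd_add u md.
  have [ot2 it2] := outd_add (u + d) md'.
  have [ot3 it3] := outd_add u md'.
  have s1 : height_step (h (u + d)) (h (u + d + d')).
    by have [] := H (u + d); rewrite ot1; case: Ed' => ->.
  have s2 : height_step (h (u + d + d')) (h (u + d')).
    have [] := H (u + d + d'); rewrite ot2 it1.
    case: Ed => ->; first by rewrite (_ : u + outd u + d' - outd u = u + d'); last ring.
    by rewrite (_ : u - outd u + d' + outd u = u + d'); last ring.
  have s3 : height_step (h (u + d')) (h u).
    have [] := H (u + d'); rewrite ot3.
    by case: Ed' => ->; rewrite ?addrK ?subrK.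
  by move: s1 s2 s3; rewrite /height_step; lia.
by split; apply: (sq (outd u)); tauto.
Qed.

Definition lower (V : set Z2) (h : Z2 -> int) (x : Z2) : int :=
  if `[< V x >] then h x - 4 else h x.

Lemma lower_in (V : set Z2) h x : V x -> lower V h x = h x - 4.
Proof. by move=> Vx; rewrite /lower; case: asboolP. Qed.

Lemma lower_notin (V : set Z2) h x : ~ V x -> lower V h x = h x.
Proof. by move=> Vx; rewrite /lower; case: asboolP. Qed.

Lemma blackb_add x d : d \in [:: e1; e2; - e1; - e2] -> blackb (x + d) = ~~ blackb x.
Proof. by rewrite !inE => /or4P[] /eqP ->; rewrite ?blackb1 ?blackb2. Qed.

(** Lowering by 4 turns the drops of 3 on leaving a point of [V] into gains of 1, and the gains of 1
    on entering it into drops of 3. Points of one colour are never adjacent, so each edge has at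
    most one end in [V]. *)
Lemma lower_height (V : set Z2) h : height h -> V `<=` local_max h ->
  (forall x y, V x -> V y -> blackb x = blackb y) -> height (lower V h).
Proof.
move=> H lm mono x.
have nbr d : d \in [:: e1; e2; - e1; - e2] -> V x -> ~ V (x + d).
  by move=> dm Vx Vy; have := mono _ _ Vx Vy; rewrite blackb_add //; case: blackb.
have st d : d = outd x \/ d = - outd x -> height_step (lower V h x) (lower V h (x + d)).
  move=> Ed.
  have dm : d \in [:: e1; e2; - e1; - e2] by case: Ed => ->; rewrite outd_mem.
  have [_ iE] := outd_add x dm.
  have hs : height_step (h x) (h (x + d)) by case: (H x) => ? ?; case: Ed => ->.
  have [Vx|nVx] := pselect (V x).
    rewrite lower_in // lower_notin; last exact: nbr.
    by have [? ?] := lm _ Vx; left; case: Ed => ->; lia.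
  rewrite (lower_notin _ nVx).
  have [Vy|nVy] := pselect (V (x + d)); last by rewrite lower_notin.
  rewrite lower_in //; have [] := local_max_ind H (lm _ Vy); rewrite iE.
  by case: Ed => ->; rewrite ?addrK ?subrK /height_step; lia.
by split; apply: st; [left|right].
Qed.

(** At a local maximum the covered edges are the two leaving ones; after lowering they are the two
    entering ones, which are perpendicular. So a pair of parallel dominoes is replaced by the other
    pair. *)
Lemma flip_lower L u h (V := [set u + l | l in L]) : L 0 ->
  (forall x l, L l -> blackb (x + l) = blackb x) ->
  height h -> V `<=` local_max h ->
  flip L (height_tiling h) (height_tiling (lower V h)) /\
  flip L (height_tiling (lower V h)) (height_tiling h).
Proof.
move=> L0 Lb H lm.
have Vb x : V x -> blackb x = blackb u by case=> l Ll <-; exact: Lb.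
have nbr x d : d \in [:: e1; e2; - e1; - e2] -> V x -> ~ V (x + d).
  move=> dm Vx Vy; have := Vb _ Vy; rewrite blackb_add // Vb //; by case: blackb.
have diag x : V x ->
    [/\ covered h x (x + outd u), covered h x (x - outd u),
        ~ covered h x (x + ind u) & ~ covered h x (x - ind u)] /\
    [/\ covered (lower V h) x (x + ind u), covered (lower V h) x (x - ind u),
        ~ covered (lower V h) x (x + outd u) & ~ covered (lower V h) x (x - outd u)].
  move=> Vx.
  have [oE iE] : outd u = outd x /\ ind u = ind x by rewrite /outd /ind Vb.
  have [hp hm] := lm _ Vx.
  have [ip im] := local_max_ind H (lm _ Vx).
  rewrite oE iE /covered lower_in // !lower_notin; try (apply: nbr; rewrite ?outd_mem//).
  by rewrite hp hm ip im; split; split; lia.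
case: (boolP (blackb u)) => bu.
  by apply: (@flip_height_tiling L u) => // x Vx; first exact: lower_notin;
    have := diag _ Vx; rewrite /outd /ind bu; case.
(* For white [u] the leaving edges are horizontal, so the vertical pair comes first and
   [flip_height_tiling] is applied with the two functions exchanged. *)
rewrite and_comm.
by apply: (@flip_height_tiling L u) => // x Vx; first (by rewrite lower_notin);
  have := diag _ Vx; rewrite /outd /ind (negbTE bu); case.
Qed.

(** * Ascending paths modulo the lattice *)

Lemma ascend h x : height h -> ~ local_max h x ->
  exists2 d, d = outd x \/ d = - outd x & h (x + d) = h x + 1.
Proof.
move=> H nlm; have [[hp|hp] [hm|hm]] := H x.
- by exists (outd x); first by left.
- by exists (outd x); first by left.
- by exists (- outd x); first by right.
- by case: nlm.
Qed.

Lemma lt_sum_abs (T : finType) (f g : T -> int) (p : T) :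
  (forall q, (`|f q| <= `|g q|)%N) -> (`|f p| < `|g p|)%N ->
  (\sum_q `|f q| < \sum_q `|g q|)%N.
Proof.
move=> le lt; rewrite (bigD1 p) //= [X in (_ < X)%N](bigD1 p) //=.
by rewrite -addSn leq_add // leq_sum.
Qed.

(* An infinite ascending path alternates horizontal and vertical steps, so [2 n] of
   its steps advance by at most [n] in each coordinate; two of its points are
   congruent modulo [D], and there [slack] bounds the rise below [2 n]. *)
Lemma no_ascending_path (L : set Z2) (D : nat) (c : Z2 -> int) (h : Z2 -> int)
    (S : set Z2) x0 :
  (forall k1 k2 : int, L (D.+1%:Z * k1, D.+1%:Z * k2)) ->
  (forall x l, L l -> h (x + l) = h x + c l) ->
  (forall v (n : nat), L v -> (0 < n)%N -> `|v.1| <= n%:Z -> `|v.2| <= n%:Z ->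
     c v < 2 * n%:Z) ->
  S x0 ->
  ~ (forall x, S x -> exists d,
       [/\ d = outd x \/ d = - outd x, h (x + d) = h x + 1 & S (x + d)]).
Proof.
move=> LD hc slack S0 asc.
have /choice [F FP] : forall x, exists y, S x ->
    [/\ y = x + outd x \/ y = x - outd x, h y = h x + 1 & S y].
  move=> x; have [/asc[d [Ed hd Sd]]|nS] := pselect (S x); last by exists x.
  by exists (x + d) => _; split => //; case: Ed => ->; [left|right].
pose y m := iter m (fun x => F (F x)) x0.
have yS m : S (y m).
  by elim: m => [//|m IH] /=; have [_ _ /FP[]] := FP _ IH.
have yh m : h (y m) = h x0 + 2 * m%:Z.
  elim: m => [|m IH]; first by rewrite mulr0 addr0.
  have [_ E /FP[_ E' _]] := FP _ (yS m).
  by rewrite [y _]/= E' E IH; lia.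
have yd m : `|(y m.+1).1 - (y m).1| <= 1 /\ `|(y m.+1).2 - (y m).2| <= 1.
  rewrite [y m.+1]/=; have [A _ /FP[B _ _]] := FP _ (yS m).
  have E : outd (F (y m)) = ind (y m).
    by case: A => ->; case: (@outd_add (y m) (outd (y m))) => //; rewrite ?outd_mem //;
      case: (@outd_add (y m) (- outd (y m))) => //; rewrite ?outd_mem.
  move: B; rewrite E; case: A => -> -[] ->; rewrite /outd /ind; case: blackb;
    case: (y m) => a b /=; lia.
have ydd m k : `|(y (m + k)%N).1 - (y m).1| <= k%:Z /\ `|(y (m + k)%N).2 - (y m).2| <= k%:Z.
  elim: k => [|k IH]; first by rewrite addn0 !subrr normr0.
  by rewrite addnS; have := yd (m + k)%N; lia.
(* Residues lie below [D.+1], so [inord] never falls back on its default value. *)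
pose cls (x : Z2) : 'I_D.+1 * 'I_D.+1 :=
  (inord `|(x.1 %% D.+1%:Z)%Z|%N, inord `|(x.2 %% D.+1%:Z)%Z|%N).
have clsE x x' : cls x = cls x' -> exists k1 k2, x' - x = (D.+1%:Z * k1, D.+1%:Z * k2).
  case: x x' => [a b] [a' b'] /pair_equal_spec [/(congr1 val) /= E1 /(congr1 val) /= E2].
  have lt (z : int) : (`|(z %% D.+1%:Z)%Z| < D.+1)%N by lia.
  rewrite !inordK // in E1 E2.
  exists ((a' %/ D.+1%:Z)%Z - (a %/ D.+1%:Z)%Z), ((b' %/ D.+1%:Z)%Z - (b %/ D.+1%:Z)%Z).
  by congr pair; rewrite /=; lia.
pose f (i : 'I_(#|{: 'I_D.+1 * 'I_D.+1}|.+1)) := cls (y i).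
have [i [j [ij E]]] : exists i j, (i < j)%N /\ cls (y i) = cls (y j).
  apply: contrapT => no; have : injective f.
    move=> i j E; apply: val_inj; apply/eqP; rewrite eqn_leq.
    by apply/andP; split; rewrite leqNgt; apply/negP => lt; apply: no;
      [exists j, i|exists i, j].
  by move/leq_card; rewrite card_ord ltnn.
have [k1 [k2 vE]] := clsE _ _ E.
have Lv : L (y j - y i) by rewrite vE.
have := hc (y i) _ Lv; rewrite addrC subrK !yh => cE.
have [] := ydd i (j - i)%N; rewrite subnKC ?(ltnW ij) // => b1 b2.
have := slack _ (j - i)%N Lv; rewrite subn_gt0 ij => /(_ isT b1 b2).
by lia.
Qed.

(** * Descent on the distance between two height functions *)

Definition box_pt (D : nat) (p : 'I_D * 'I_D) : Z2 := ((p.1 : nat)%:Z, (p.2 : nat)%:Z).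

(** Division with remainder of both coordinates by [D.+1]. The box may meet a class modulo [L]
    several times; meeting each class is enough to find the maximum of a periodic function. *)
Lemma box_ptP (L : set Z2) D x :
  (forall k1 k2 : int, L (D.+1%:Z * k1, D.+1%:Z * k2)) ->
  exists2 p : 'I_D.+1 * 'I_D.+1, exists2 l, L l & box_pt p + l = x &
    exists2 l, L l & x + l = box_pt p.
Proof.
move=> LD; case: x => a b.
have lt (z : int) : (`|(z %% D.+1%:Z)%Z| < D.+1)%N by lia.
exists (Ordinal (lt a), Ordinal (lt b)).
  exists (D.+1%:Z * (a %/ D.+1%:Z)%Z, D.+1%:Z * (b %/ D.+1%:Z)%Z); first exact: LD.
  by congr pair; rewrite /=; lia.
exists (D.+1%:Z * - (a %/ D.+1%:Z)%Z, D.+1%:Z * - (b %/ D.+1%:Z)%Z); first exact: LD.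
by congr pair; rewrite /=; lia.
Qed.

Definition quasiperiodic (L : set Z2) (c h : Z2 -> int) : Prop :=
  forall x l, L l -> h (x + l) = h x + c l.

Definition box_dist D (h1 h2 : Z2 -> int) : nat :=
  \sum_(p : 'I_D * 'I_D) `|h1 (box_pt p) - h2 (box_pt p)|%N.

Lemma outd_shift (L : set Z2) x l : (forall x l, L l -> blackb (x + l) = blackb x) ->
  L l -> outd (x + l) = outd x.
Proof. by move=> Lb Ll; rewrite /outd Lb. Qed.

(** Where [h1 - h2] is largest it is a positive multiple of 4, so lowering [h1] by 4 on an orbit
    there cannot overshoot [h2]. *)
Lemma descent_step (L : set Z2) (D : nat) (c h1 h2 : Z2 -> int) :
  (forall x y, L x -> L y -> L (x - y)) ->
  (forall k1 k2 : int, L (D.+1%:Z * k1, D.+1%:Z * k2)) ->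
  (forall x l, L l -> blackb (x + l) = blackb x) ->
  (forall v (n : nat), L v -> (0 < n)%N -> `|v.1| <= n%:Z -> `|v.2| <= n%:Z ->
     c v < 2 * n%:Z) ->
  height h1 -> height h2 -> quasiperiodic L c h1 -> quasiperiodic L c h2 ->
  (forall x, (4 %| h1 x - h2 x)%Z) ->
  (exists x, h2 x < h1 x) ->
  exists h, [/\ height h /\ quasiperiodic L c h, forall x, (4 %| h x - h2 x)%Z,
    flip L (height_tiling h1) (height_tiling h),
    flip L (height_tiling h) (height_tiling h1) &
    (box_dist D.+1 h h2 < box_dist D.+1 h1 h2)%N].
Proof.
move=> LB LD Lb slack H1 H2 q1 q2 mod4 [x1 gt0].
have L0 : L 0 by have := LD 0 0; rewrite !mulr0.
have LN x : L x -> L (- x) by rewrite -[- x]add0r; exact: LB.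
have LA x y : L x -> L y -> L (x + y) by move=> Lx Ly; rewrite -[y]opprK; apply: LB; last exact: LN.
pose g x := h1 x - h2 x.
have gp x l : L l -> g (x + l) = g x by move=> Ll; rewrite /g q1 // q2 //; ring.
have [x0 gmax] : exists x0, forall x, g x <= g x0.
  have [p0 _ _] := box_ptP 0 LD.
  case: (@Order.TotalTheory.arg_maxP _ _ _ p0 predT (fun p => g (box_pt p))) => // p _ pm.
  exists (box_pt p) => x; have [q [l Ll <-] _] := box_ptP x LD.
  by rewrite gp //; exact: pm.
have [u gu lmu] : exists2 u, g u = g x0 & local_max h1 u.
  apply: contrapT => no.
  apply: (no_ascending_path (S := [set x | g x = g x0]) (x0 := x0) LD q1 slack) => //.
  move=> x /= gx.
  have [|d Ed hd] := ascend H1 (x := x); first by move=> lm; apply: no; exists x.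
  exists d; split=> //=.
  (* A drop of 3 for [h2] would push [g] 4 above its maximum, so [h2] gains 1 as well. *)
  have : height_step (h2 x) (h2 (x + d)) by case: (H2 x) => ? ?; case: Ed => ->.
  by have := gmax (x + d); move: gx hd; rewrite /g /height_step; lia.
pose V := [set u + l | l in L].
have lmV : V `<=` local_max h1.
  move=> _ [l Ll <-]; rewrite /local_max (outd_shift _ Lb Ll).
  have sw d : u + l + d = u + d + l by ring.
  rewrite !sw !(q1 _ l Ll).
  by case: lmu => -> ->; split; ring.
have gV x : V x -> g x = g x0 by case=> l Ll <-; rewrite gp.
have VL x l : L l -> V (x + l) <-> V x.
  move=> Ll; split=> -[m Lm E].
    by exists (m - l); [exact: LB | rewrite addrA E addrK].
  by exists (m + l); [exact: LA | rewrite addrA E].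
have [f1 f2] := flip_lower L0 Lb H1 lmV.
have g4 : 4 <= g x0.
  by have := gmax x1; have := mod4 x1; have := mod4 x0; move: gt0; rewrite /g; lia.
exists (lower V h1); split=> //.
- split.
    apply: lower_height => // x y [l Ll <-] [m Lm <-].
    by rewrite !Lb.
  move=> x l Ll; have [Vx|nVx] := pselect (V x).
    by rewrite !lower_in // ?q1 //; [ring | apply/VL].
  by rewrite !lower_notin // ?q1 //; move/VL => /(_ Ll).
- move=> x; have [Vx|nVx] := pselect (V x); last by rewrite lower_notin.
  by rewrite lower_in //; have := mod4 x; lia.
- have [p _ [l Ll E]] := box_ptP u LD.
  have Vp : V (box_pt p) by exists l.
  apply: (lt_sum_abs (p := p)) => [q|].
    have [Vq|nVq] := pselect (V (box_pt q)); last by rewrite lower_notin.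
    by rewrite lower_in //; have := gV _ Vq; rewrite /g in g4 *; lia.
  by rewrite lower_in //; have := gV _ Vp; rewrite /g in g4 *; lia.
Qed.

(** Whichever function is somewhere above the other gets lowered. For the sequence from [h1] to
    [h2], lowering [h1] prepends a flip, and lowering [h2] appends the reverse of one. *)
Lemma joined_by_heights (L : set Z2) (D : nat) (c h1 h2 : Z2 -> int) :
  (forall x y, L x -> L y -> L (x - y)) ->
  (forall k1 k2 : int, L (D.+1%:Z * k1, D.+1%:Z * k2)) ->
  (forall x l, L l -> blackb (x + l) = blackb x) ->
  (forall v (n : nat), L v -> (0 < n)%N -> `|v.1| <= n%:Z -> `|v.2| <= n%:Z ->
     c v < 2 * n%:Z) ->
  height h1 -> height h2 -> quasiperiodic L c h1 -> quasiperiodic L c h2 ->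
  (forall x, (4 %| h1 x - h2 x)%Z) ->
  joined_by_flips L (height_tiling h1) (height_tiling h2) /\
  joined_by_flips L (height_tiling h2) (height_tiling h1).
Proof.
move=> LB LD Lb slack.
have distC a b : box_dist D.+1 a b = box_dist D.+1 b a.
  by apply: eq_bigr => p _; lia.
have snoc a b e : joined_by_flips L a b -> flip L b e -> joined_by_flips L a e.
  move=> ab be; apply: clos_rt_rt1n; apply: (rt_trans _ _ _ b); last exact: rt_step.
  exact: clos_rt1n_rt ab.
have cons a b e : flip L a b -> joined_by_flips L b e -> joined_by_flips L a e.
  by move=> ab be; exact: Relation_Operators.rt1n_trans ab be.
(* Induction on a bound [n] for the distance. For [n = 0] a strict decrease is absurd, which leaves
   only equal functions. *)
move: {2}(box_dist _ _ _) (leqnn (box_dist D.+1 h1 h2)) => n.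
elim: n h1 h2 => [|n IH] h1 h2 le H1 H2 q1 q2 mod4.
all: have [lt12|nlt12] := pselect (exists x, h2 x < h1 x).
1,3: have [h [[H q] m f f' lt]] := descent_step LB LD Lb slack H1 H2 q1 q2 mod4 lt12.
- by move: (leq_trans lt le).
- have [|j j'] := IH h h2 _ H H2 q q2 m; first exact: leq_trans lt le.
  by split; [exact: cons f j | exact: snoc j' f'].
all: have mod4' x : (4 %| h2 x - h1 x)%Z by have := mod4 x; lia.
all: have [lt21|nlt21] := pselect (exists x, h1 x < h2 x).
1,3: have [h [[H q] m f f' lt]] := descent_step LB LD Lb slack H2 H1 q2 q1 mod4' lt21.
1,2: rewrite distC [X in (_ < X)%N]distC in lt.
- by move: (leq_trans lt le).
- have m' x : (4 %| h1 x - h x)%Z by have := m x; lia.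
  have [|j j'] := IH h1 h _ H1 H q1 q m'; first exact: leq_trans lt le.
  by split; [exact: snoc j f' | exact: cons f j'].
all: have -> : h1 = h2 by apply/funext => x; apply: le_anti; apply/andP; split;
  rewrite leNgt; apply/negP => ?; [apply: nlt12|apply: nlt21]; exists x.
all: by split; exact: rt1n_refl.
Qed.

(** * Valid lattices, heights modulo 4, and the bound from the flux *)

Lemma valid_lattice_sub (L : set Z2) x y : valid_lattice L -> L x -> L y -> L (x - y).
Proof.
move=> [a [b [_ _ _ ->]]] [m [n ->]] [p [q ->]]; exists (m - p), (n - q).
by rewrite !mulrzBr; ring.
Qed.

Lemma pairMzE (p q k : int) : ((p, q) : Z2) *~ k = (p * k, q * k).
Proof.
rewrite [LHS]surjective_pairing; congr pair.
  by rewrite (raddfMz (fst : Z2 -> int)) /= mulrzz.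
by rewrite (raddfMz (snd : Z2 -> int)) /= mulrzz.
Qed.

(** Both generators have coordinates of equal parity, so every vector of [L] has an even coordinate
    sum. *)
Lemma valid_lattice_blackb (L : set Z2) x l : valid_lattice L -> L l ->
  blackb (x + l) = blackb x.
Proof.
have ev v : (even_points `|` odd_points) v -> (2 %| v.1 + v.2)%Z.
  by case=> -[[i j] _ <-] /=; lia.
move=> [a [b [/ev Ea /ev Eb _ ->]]] [m [n ->]].
case: a b x Ea Eb => [a1 a2] [b1 b2] [x1 x2]; rewrite /blackb !pairMzE /=.
move=> /dvdzP[s Es] /dvdzP[t Et].
rewrite (_ : x1 + _ + _ = x1 + x2 + (s * m + t * n) * 2); first by lia.
rewrite mulrDl [s * m * 2]mulrAC [t * n * 2]mulrAC -Es -Et; ring.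
Qed.

(** Cramer's rule: the determinant of the generators times any integer vector is an integer
    combination of them. *)
Lemma valid_lattice_box (L : set Z2) : valid_lattice L ->
  exists D : nat, forall k1 k2 : int, L (D.+1%:Z * k1, D.+1%:Z * k2).
Proof.
move=> [[a1 a2] [[b1 b2] [_ _ li ->]]].
pose det := a1 * b2 - a2 * b1.
have det0 : det != 0.
  (* If [det = 0], two combinations of the generators with their own coordinates as coefficients
     vanish; independence makes all coordinates zero, which contradicts it. *)
  apply/eqP => d0.
  have [b20 a20] : b2 = 0 /\ - a2 = 0.
    by apply: li; rewrite !pairMzE; congr pair; move: d0; rewrite /det /=; lia.
  have [b10 a10] : b1 = 0 /\ - a1 = 0.
    by apply: li; rewrite !pairMzE; congr pair; move: d0; rewrite /det /=; lia.
  have [] : (1 : int) = 0 /\ (0 : int) = 0; last by [].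
  by apply: li; rewrite !pairMzE; congr pair; rewrite /=; lia.
have [s sE] : exists s : int, `|det|%N%:Z = s * det.
  by have [?|?] := leP 0 det; [exists 1|exists (-1)]; lia.
exists `|det|%N.-1 => k1 k2; rewrite prednK ?absz_gt0 // sE.
exists (s * (b2 * k1 - b1 * k2)), (s * (a1 * k2 - a2 * k1)).
by rewrite !pairMzE; congr pair; rewrite /= /det; ring.
Qed.

(** A gain of 1 and a drop of 3 agree modulo 4, so divisibility of the difference by 4 is carried
    along every edge, and unit steps from 0 reach [x]. *)
Lemma height_mod4 h1 h2 x : height h1 -> height h2 -> h1 0 = h2 0 ->
  (4 %| h1 x - h2 x)%Z.
Proof.
move=> H1 H2 E0; pose P y := (4 %| h1 y - h2 y)%Z.
have step y d : d = e1 \/ d = e2 -> P (y + d) = P y.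
  move=> Ed; have [od|od] : d = outd y \/ d = ind y.
      by rewrite /outd /ind; case: blackb; tauto.
    have [+ _] := H1 y; have [+ _] := H2 y; rewrite -od /height_step /P; lia.
  have [|oE _] := @outd_add y d; first by case: Ed => ->.
  have [_] := H1 (y + d); have [_] := H2 (y + d).
  by rewrite oE -od addrK /height_step /P; lia.
have stepn y d n : d = e1 \/ d = e2 -> P (y + d *+ n) = P y.
  by move=> Ed; elim: n => [|n IH]; rewrite ?addr0 // mulrSr addrA step.
have stepz y d (z : int) : d = e1 \/ d = e2 -> P (y + d *~ z) = P y.
  move=> Ed; case: z => n; first exact: stepn.
  by rewrite NegzE mulrNz -(stepn _ d n.+1 Ed) subrK.
rewrite -/(P x) (_ : x = 0 + e1 *~ x.1 + e2 *~ x.2); last first.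
  by case: x => a b; rewrite !pairMzE; congr pair; rewrite /=; lia.
by rewrite stepz ?stepz ?/P ?E0 ?subrr; [| left | right].
Qed.

Lemma interior_Qset (R : realType) (p : R * R) :
  (Qset R)° p -> `|p.1| + `|p.2| < 2^-1.
Proof.
case: p => x y /nbhs_ballP [e /= e0 be].
have q z : `|x - z| < e -> `|z| + `|y| <= 2^-1.
  move=> hz; apply: (be (z, y)); split; rewrite -ball_normE //=.
  by rewrite subrr normr0.
(* The first coordinate is pushed away from 0 by [e / 2]; the pushed point is still in [Qset], which
   leaves a margin of [e / 2]. *)
have := q (x + (if 0 <= x then e / 2 else - (e / 2))).
case: ifPn => x0; rewrite opprD addrA subrr add0r normrN ?normrN gtr0_norm ?divr_gt0 //.
  by rewrite (ger0_norm x0) ger0_norm; move: x0 e0; lra.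
rewrite -ltNge in x0.
by rewrite (ltr0_norm x0) ltr0_norm; move: x0 e0; lra.
Qed.

(** By the triangle inequality [4 * dotZ phi v] is at most 4 n times the sum of the absolute values
    of the coordinates of [phi], hence below 2 n. *)
Lemma flux_slack (R : realType) (phi : R * R) (v : Z2) (z : int) (n : nat) :
  `|phi.1| + `|phi.2| < 2^-1 -> 4 * dotZ phi v = z%:~R -> (0 < n)%N ->
  `|v.1| <= n%:Z -> `|v.2| <= n%:Z -> z < 2 * n%:Z.
Proof.
case: phi v => [x y] [i j]; rewrite /dotZ /= => xy E n0 hi hj.
have n0R : (0 : R) < n%:R by rewrite ltr0n.
have bound (w : R) (k : int) : `|k| <= n%:Z -> w * k%:~R <= `|w| * n%:R.
  move=> hk; apply: le_trans (ler_norm _) _; rewrite normrM ler_wpM2l //.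
  by rewrite -intr_norm -[n%:R]/(n%:Z%:~R) ler_int.
rewrite -(ltr_int R) -E intrM.
have := bound x _ hi; have := bound y _ hj.
have : (`|x| + `|y|) * n%:R < 2^-1 * n%:R by rewrite ltr_pM2r.
by rewrite mulrDl -[n%:Z%:~R]/(n%:R); lra.
Qed.

Theorem corollary6p2p6 (R : realType) (L : set Z2) (phi : R * R)
    (hL : valid_lattice L) (hphi : (fluxes R L `&` (Qset R)°) phi)
    (t1 t2 : set (set Z2))
    (ht1 : torus_tiling L t1) (ht2 : torus_tiling L t2)
    (hphi1 : is_flux L t1 phi) (hphi2 : is_flux L t2 phi)
    (hne : t1 <> t2) :
  joined_by_flips L t1 t2.
Proof.
have [[tt1 _] [tt2 _]] := (ht1, ht2).
case: hphi1 hphi2 => [h1 H1 q1] [h2 H2 q2].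
have [D LD] := valid_lattice_box hL.
rewrite (is_height_tiling tt1 H1) (is_height_tiling tt2 H2).
(* As [h1 0 = 0], the increment along [v] is [h1 v]; so [h1] itself serves as [c], for both height
   functions because the fluxes coincide. *)
have cE v : L v -> 4 * dotZ phi v = (h1 v)%:~R.
  by move=> Lv; rewrite (q1 _ 0 Lv) add0r (proj1 H1) subr0.
have quasi h : (forall v u, L v -> 4 * dotZ phi v = (h (u + v) - h u)%:~R) ->
    quasiperiodic L h1 h.
  move=> q u v Lv; have := q v u Lv; rewrite cE // => /intr_inj ->; ring.
have [Hh1 Hh2] := (is_height_height H1, is_height_height H2).
apply: proj1 (@joined_by_heights L D h1 h1 h2 _ LD _ _ Hh1 Hh2 (quasi _ q1) (quasi _ q2) _).
- by move=> x y; exact: valid_lattice_sub.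
- by move=> x l; exact: valid_lattice_blackb.
- move=> v n Lv; apply: flux_slack (cE _ Lv).
  by apply: interior_Qset; case: hphi.
- by move=> x; apply: height_mod4 => //; rewrite (proj1 H1) (proj1 H2).
Qed.
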